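(* Let $\mathcal{F}:\mathbb{K}[x^{\pm1},y^{\pm1}]\to\mathbb{K}$ be a linear functional over a field $\mathbb{K}$ with moments $f_{i,j}=\mathcal{F}[x^iy^j]$ such that all determinants $\Delta^{(r,c)}_n$ ($(r,c)\in\mathbb{Z}^2$, $n\in\mathbb{Z}_{\ge0}$) are nonzero. Assume that the label $\alpha_{i,j}$ of the vertical edge between $(i,j)$ and $(i-1,j)$ of the square lattice $\mathbb{Z}_{\ge0}^2$ is $$\alpha_{i,j} = a^{(i-j-1,0)}_{j}\ \text{ if } i>j, \qquad \alpha_{i,j}= b^{(0,j-i)}_{i}\ \text{ if } i\le j,$$ for each $(i,j)$ with $(i-1,j)\in\mathbb{Z}_{\ge 0}^{2}$. Let $(r,c) \in \mathbb{Z}_{\ge 0}^{2}$. Then $$\frac{f_{r,c}}{f_{0,c}} = \sum_{P} w(P),$$ where the sum ranges over all the lattice paths $P$ on the square lattice $\mathbb{Z}_{\ge 0}^{2}$ going from $(r,0)$ to $(0,c)$.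
   Context: For $(r,c)\in\mathbb{Z}^2$ and $n\in\mathbb{Z}_{\ge0}$, $\Delta^{(r,c)}_n=\det_{0\le i,j<n}(f_{r+i,c+j})$, with $\Delta^{(r,c)}_0=1$. The biorthogonal polynomial $P^{(r,c)}_n(x)\in\mathbb{K}[x]$ is the unique monic polynomial of degree $n$ with $\mathcal{F}[x^ry^{c+j}P^{(r,c)}_n(x)]=h^{(r,c)}_n\delta_{j,n}$ for $0\le j\le n$, where $h^{(r,c)}_n=\Delta^{(r,c)}_{n+1}/\Delta^{(r,c)}_n$. The coefficients $$a^{(r,c)}_n=\frac{h^{(r+1,c)}_n}{h^{(r,c)}_n}=\frac{\Delta^{(r+1,c)}_{n+1}\Delta^{(r,c)}_n}{\Delta^{(r+1,c)}_n\Delta^{(r,c)}_{n+1}}\ (n\ge0),\qquad b^{(r,c)}_n=\frac{h^{(r,c)}_n}{h^{(r,c+1)}_{n-1}}=\frac{\Delta^{(r,c)}_{n+1}\Delta^{(r,c+1)}_{n-1}}{\Delta^{(r,c)}_n\Delta^{(r,c+1)}_n}\ (n\ge1)$$ are those of the adjacent relations $xP^{(r+1,c)}_n=P^{(r,c)}_{n+1}+a^{(r,c)}_nP^{(r,c)}_n$ and $P^{(r,c)}_n=P^{(r,c+1)}_n+b^{(r,c)}_nP^{(r,c+1)}_{n-1}$ (with $P^{(r,c+1)}_{-1}=0$). The square lattice $\mathbb{Z}_{\ge0}^2$ is drawn in matrix-like coordinates: the south and east neighbours of $(i,j)$ are $(i+1,j)$ and $(i,j+1)$. Each vertical edge between $(i,j)$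 and $(i-1,j)$ ($i\ge1$, $j\ge0$) carries the label $\alpha_{i,j}\in\mathbb{K}$ and each horizontal edge the label $1$. A lattice path consists of unit north steps $(i,j)\to(i-1,j)$ and unit east steps $(i,j)\to(i,j+1)$; it may be empty (no steps). Its weight $w(P)$ is the product of the labels of all edges it traverses (the empty path has weight $1$). *)

(* Defs.v *)
From HB Require Import structures.
From mathcomp Require Import all_boot all_order all_algebra.
From mathcomp Require Import monalg.

Set Implicit Arguments.
Unset Strict Implicit.
Unset Printing Implicit Defensive.

Import GRing.Theory.
Local Open Scope ring_scope.

(** ** Moments and their determinants *)

(* The K-vector space underlying K[x^{+-1}, y^{+-1}]: finitely supported
   coefficient functions on Z^2, the basis vector << (i, j) >> being x^i y^j.
   monalg puts no ring structure on it, as it asks for monoids of exponents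
   with no nontrivial invertible element; linear functionals use none. *)
Definition laurent2 (K : fieldType) := {malg K[(int * int)%type]}.

HB.instance Definition _ (K : fieldType) := GRing.Lmodule.on (laurent2 K).

Definition lmonom (K : fieldType) (i j : int) : laurent2 K := << (i, j) >>.

Section Moments.

Variables (K : fieldType) (F : {linear laurent2 K -> K^o}).

Definition moment (i j : int) : K := F (lmonom K i j).

Definition Delta (r c : int) (n : nat) : K :=
  \det (\matrix_(i < n, j < n) moment (r + i%:Z) (c + j%:Z)).

(* This ratio is F[x^r y^(c+n) P(x)], where P is the unique monic polynomial of
   degree n such that F[x^r y^(c+j) P(x)] = 0 for all j < n. *)
Definition hcoef (r c : int) (n : nat) : K := Delta r c n.+1 / Delta r c n.

Definition acoef (r c : int) (n : nat) : K :=
  hcoef (r + 1) c n / hcoef r c n.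

(* Only meaningful for 0 < n. *)
Definition bcoef (r c : int) (n : nat) : K :=
  hcoef r c n / hcoef r (c + 1) n.-1.

End Moments.

(** ** Lattice paths on the quarter plane *)

(* Matrix-like coordinates: the first one grows southwards, the second one
   eastwards. *)
Definition vertex : Type := (nat * nat)%type.

Definition north_step (u v : vertex) : bool :=
  (u.1 == v.1.+1) && (u.2 == v.2).

Definition east_step (u v : vertex) : bool :=
  (v.1 == u.1) && (v.2 == u.2.+1).

Definition lattice_step : rel vertex :=
  fun u v => north_step u v || east_step u v.

(* A path from u to v is given by the vertices it visits after u. *)
Definition is_lattice_path (u v : vertex) (p : seq vertex) : bool :=
  path lattice_step u p && (last u p == v).

Record lattice_path (u v : vertex) : Type := LatticePath {
  path_vertices :> seq vertex;
  _ : is_lattice_path u v path_vertices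
}.

HB.instance Definition _ u v := [isSub for @path_vertices u v].
HB.instance Definition _ u v := [Countable of lattice_path u v by <:].

Section PathsFinite.

Definition successors (u : vertex) : seq vertex :=
  [:: (u.1.-1, u.2); (u.1, u.2.+1)].

Fixpoint walks (n : nat) (u : vertex) : seq (seq vertex) :=
  if n is n'.+1 then [seq w :: p | w <- successors u, p <- walks n' w]
  else [:: [::]].

Lemma mem_walks u p : path lattice_step u p -> p \in walks (size p) u.
Proof.
elim: p u => [|w p IHp] u //; case/andP=> uw wp.
have w_succ : w \in successors u.
  case: u w uw {IHp wp} => [i j] [i' j']; rewrite !inE.
  case/orP=> /andP[/eqP /= -> /eqP /= ->]; first by rewrite eqxx.
  by rewrite eqxx orbT.
by apply/allpairsPdep; exists w, p; split=> //; apply: IHp.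
Qed.

Lemma size_lattice_path u v p :
  is_lattice_path u v p -> size p = (u.1 + v.2 - (u.2 + v.1))%N.
Proof.
case/andP=> up /eqP pv.
suff: (size p + (u.2 + v.1) = u.1 + v.2)%N by move<-; rewrite addnK.
rewrite -{}pv; elim: p u up => [|w p IHp] u /=; first by rewrite add0n addnC.
case/andP=> uw /IHp IH; case/orP: uw => /andP[/eqP e1 /eqP e2].
  by rewrite e1 e2 !addSn IH.
by rewrite -e1 -IH e2 !addSn addnS.
Qed.

Definition lattice_path_enum u v : seq (lattice_path u v) :=
  undup (pmap insub (walks (u.1 + v.2 - (u.2 + v.1)) u)).

Lemma lattice_path_enumP u v : Finite.axiom (lattice_path_enum u v).
Proof.
apply: Finite.uniq_enumP => [|P]; first exact: undup_uniq.
rewrite mem_undup mem_pmap_sub /= -(size_lattice_path (valP P)).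
by apply: mem_walks; case/andP: (valP P).
Qed.

End PathsFinite.

HB.instance Definition _ u v :=
  isFinite.Build (lattice_path u v) (@lattice_path_enumP u v).

Section Weights.

Variables (K : fieldType) (alpha : nat -> nat -> K).

(* alpha i j labels the vertical edge between (i, j) and (i - 1, j). *)
Definition step_label (u v : vertex) : K :=
  if north_step u v then alpha u.1 u.2 else 1.

Definition path_weight (u v : vertex) (P : lattice_path u v) : K :=
  \prod_(l <- pairmap step_label u P) l.

End Weights.

(* Main.v *)
Require Import Defs.
From HB Require Import structures.
From mathcomp Require Import all_boot all_order all_algebra.
From mathcomp Require Import zify.

(** The sums over lattice paths from (i, j) to (0, c) obey a two-term recurrence
    in (i, j): a path starts with a north step or with an east step. The labels
    are chosen so that the adjacent relations of the biorthogonal polynomials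
    P^(r,c)_n are this same recurrence. Put

      Q(i, j) = x^(i-j) P^(i-j, 0)_j  if j < i,   Q(i, j) = P^(0, j-i)_i  if i <= j.

    Multiplied by x^(i-j-1), the relation
    x P^(r+1,c)_n = P^(r,c)_(n+1) + a P^(r,c)_n yields
    Q(i, j) = Q(i, j+1) + alpha(i, j) Q(i-1, j) below the diagonal, and
    P^(r,c)_n = P^(r,c+1)_n + b P^(r,c+1)_(n-1) yields the same equation on and
    above it ([staircase_rec]).

    Hence g(i, j) = F[y^c Q(i, j)] satisfies the recurrence of the path sums.
    The boundary values agree up to the factor f_(0,c): Q(0, j) = 1 gives
    g(0, j) = f_(0,c), and orthogonality gives g(i, c+1) = 0 for i > 0, whereas
    no path starts east of its target. Therefore g(i, j) is f_(0,c) times the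
    path sum ([path_sum_unique]), and Q(r, 0) = x^r gives g(r, 0) = f_(r,c).

    The polynomials come from the last row of the adjugate of the moment
    matrix ([biorth]), which displays both their orthogonality and their norm
    h^(r,c)_n ([biorth_orth], [biorth_norm]). An adjacent relation holds because
    the difference of its two sides has low degree and is orthogonal to
    sufficiently many powers of y ([orth_eq0]); the values of a and b are the
    ones that cancel the last of these moments. *)

Set Implicit Arguments.
Unset Strict Implicit.
Unset Printing Implicit Defensive.

Import GRing.Theory.
Local Open Scope ring_scope.

(** * Sums over lattice paths *)

Section PathSums.

Variables (K : fieldType) (alpha : nat -> nat -> K).

Definition path_sum (u v : vertex) : K :=
  \sum_(P : lattice_path u v) path_weight alpha P.

Definition seq_weight (u : vertex) (p : seq vertex) : K :=
  \prod_(l <- pairmap (step_label alpha) u p) l.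

Lemma walks_uniq n u : uniq (walks n u).
Proof.
elim: n u => // n IHn u; apply: allpairs_uniq_dep => //.
- by rewrite /= inE xpair_eqE; lia.
- by move=> [x p] [y q] _ _ /= [-> ->].
Qed.

(** Walks may make steps that are not lattice steps (the truncated predecessor
    on row 0), so they have to be filtered. *)
Lemma path_sum_walks u v :
  path_sum u v =
  \sum_(p <- walks (u.1 + v.2 - (u.2 + v.1)) u | is_lattice_path u v p)
     seq_weight u p.
Proof.
rewrite -big_filter /path_sum.
rewrite -(big_map (@path_vertices u v) xpredT (seq_weight u)).
apply: perm_big; apply: uniq_perm.
- by rewrite map_inj_uniq ?index_enum_uniq //; apply: val_inj.
- by rewrite filter_uniq ?walks_uniq.
move=> p; rewrite mem_filter; apply/mapP/andP => [[P _ ->]|[pP _]].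
  split; first exact: valP P.
  rewrite -(size_lattice_path (valP P)).
  by apply: mem_walks; case/andP: (valP P).
by exists (LatticePath pP); rewrite ?mem_index_enum.
Qed.

(** Removing the first step of a path shortens it by one, and so it matches the
    recursion of [walks]. The hypothesis says that a path from u to v, if there
    is one, has at least one step: it excludes u = v. *)
Lemma path_sum_step u v : (u.2 + v.1 < u.1 + v.2)%N ->
  path_sum u v =
  (if (0 < u.1)%N then alpha u.1 u.2 * path_sum (u.1.-1, u.2) v else 0)
  + path_sum (u.1, u.2.+1) v.
Proof.
case: u v => i j [k c] /= lt_uv; rewrite path_sum_walks /=.
have -> : (i + c - (j + k) = (i + c - (j.+1 + k)).+1)%N by lia.
have step_sum w n :
    \sum_(p <- walks n w | is_lattice_path (i, j) (k, c) (w :: p))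
       seq_weight (i, j) (w :: p)
  = if lattice_step (i, j) w then step_label alpha (i, j) w *
      \sum_(p <- walks n w | is_lattice_path w (k, c) p) seq_weight w p
    else 0.
  rewrite /is_lattice_path /=; case: ifP => _ /=; last by rewrite big_pred0.
  by rewrite big_distrr; apply: eq_bigr => p _; rewrite /seq_weight /= big_cons.
rewrite /= big_cat big_cat /= !big_map big_nil Monoid.mulm1 !step_sum.
congr (_ + _).
- case: i lt_uv {step_sum} => [|i] lt_uv.
    by rewrite ifF // /lattice_step /north_step /east_step /=; lia.
  rewrite /lattice_step /step_label /north_step /= !eqxx /= path_sum_walks /=.
  by have -> : (i.+1 + c - (j.+1 + k) = i + c - (j + k))%N by lia.
- rewrite /lattice_step /step_label /east_step /north_step /= !eqxx orbT.
  by rewrite (_ : (i == i.+1) = false) ?mul1r ?path_sum_walks //=; lia.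
Qed.

Lemma lattice_path_col_le u p : path lattice_step u p -> (u.2 <= (last u p).2)%N.
Proof.
elim: p u => [|w p IHp] u //= /andP[uw /IHp]; apply: leq_trans.
by case/orP: uw => /andP[_ /eqP e]; rewrite e.
Qed.

Lemma path_sum_east0 u v : (v.2 < u.2)%N -> path_sum u v = 0.
Proof.
move=> lt_vu; rewrite /path_sum big1 // => P _.
case/andP: (valP P) => /lattice_path_col_le + /eqP e.
by rewrite e leqNgt lt_vu.
Qed.

(** On row 0 only east steps are left, so there is exactly one path. *)
Lemma path_sum_row0 j c : (j <= c)%N -> path_sum (0%N, j) (0%N, c) = 1.
Proof.
move=> le_jc; rewrite -(subKn le_jc); move: (c - j)%N (leq_subr j c) => {j le_jc}.
elim=> [|d IHd] le_dc.
  rewrite subn0 path_sum_walks /= addn0 subnn /=.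
  by rewrite big_cons big_nil /is_lattice_path /= eqxx addr0 /seq_weight big_nil.
rewrite path_sum_step /=; last by lia.
by rewrite add0r (_ : (c - d.+1).+1 = (c - d)%N) ?IHd //; lia.
Qed.

(** Descending induction on the column inside induction on the row; the
    recurrence never leaves the columns 0, ..., c+1. *)
Lemma path_sum_unique (g : nat -> nat -> K) (z : K) c :
    (forall j, (j <= c)%N -> g 0%N j = z) ->
    (forall i, g i.+1 c.+1 = 0) ->
    (forall i j, (j <= c)%N -> g i.+1 j = g i.+1 j.+1 + alpha i.+1 j * g i j) ->
  forall i j, (j <= c)%N -> g i j = z * path_sum (i, j) (0%N, c).
Proof.
move=> g_row0 g_east0 g_step; elim=> [|i IHi] j le_jc.
  by rewrite path_sum_row0 // mulr1 g_row0.
suff eq_g d : (d <= c.+1)%N ->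
    g i.+1 (c.+1 - d)%N = z * path_sum (i.+1, (c.+1 - d)%N) (0%N, c).
  by rewrite -(@subKn j c.+1) ?eq_g ?leq_subr // leqW.
elim: d => [|d IHd] le_dc; first by rewrite subn0 g_east0 path_sum_east0 ?mulr0.
rewrite subSS g_step ?leq_subr // path_sum_step /=; last by lia.
rewrite -subSn // IHd ?(ltnW le_dc) // IHi ?leq_subr // mulrDr addrC.
by congr (_ + _); rewrite mulrCA.
Qed.

End PathSums.

(** * Biorthogonal polynomials and their adjacent relations *)

Section PolyMoments.

Variables (K : fieldType) (F : {linear laurent2 K -> K^o}).
Implicit Types (r c : int) (n : nat) (p q : {poly K}).

(** This is F[x^r y^c p(x)]. *)
Definition poly_moment r c p : K :=
  \sum_(k < size p) p`_k * moment F (r + k%:Z) c.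

Definition moment_mx r c n : 'M[K]_n :=
  \matrix_(i < n, j < n) moment F (r + i%:Z) (c + j%:Z).

Lemma poly_moment_wide n r c p : (size p <= n)%N ->
  poly_moment r c p = \sum_(k < n) p`_k * moment F (r + k%:Z) c.
Proof.
move=> le_pn; rewrite /poly_moment.
rewrite (big_ord_widen n (fun k => p`_k * moment F (r + k%:Z) c) le_pn).
rewrite big_mkcond /=; apply: eq_bigr => k _; case: ltnP => // le_pk.
by rewrite nth_default ?mul0r.
Qed.

Lemma poly_moment_is_linear r c : linear (poly_moment r c : {poly K} -> K^o).
Proof.
move=> a p q.
have le_max : (size (a *: p + q)%R <= maxn (size p) (size q))%N.
  by rewrite (leq_trans (size_polyD _ _)) // geq_max !leq_max leqnn size_scale_leq orbT.
rewrite (poly_moment_wide r c le_max) (poly_moment_wide r c (leq_maxl _ (size q))).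
rewrite (poly_moment_wide r c (leq_maxr (size p) _)) scaler_sumr -big_split /=.
by apply: eq_bigr => k _; rewrite coefD coefZ mulrDl -mulrA.
Qed.

HB.instance Definition _ r c :=
  GRing.isLinear.Build K {poly K} K^o *:%R (poly_moment r c)
    (poly_moment_is_linear r c).

Lemma poly_momentD r c p q :
  poly_moment r c (p + q) = poly_moment r c p + poly_moment r c q.
Proof. exact: linearD. Qed.

Lemma poly_momentB r c p q :
  poly_moment r c (p - q) = poly_moment r c p - poly_moment r c q.
Proof. exact: linearB. Qed.

Lemma poly_momentZ r c a p : poly_moment r c (a *: p) = a * poly_moment r c p.
Proof. exact: linearZ. Qed.

Lemma poly_moment1 r c : poly_moment r c 1 = moment F r c.
Proof. by rewrite /poly_moment size_poly1 big_ord1 coef1 mul1r addr0. Qed.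

Lemma poly_momentXM r c p : poly_moment r c ('X * p) = poly_moment (r + 1) c p.
Proof.
have le_Xp : (size ('X * p)%R <= (size p).+1)%N.
  by rewrite (leq_trans (size_polyMleq _ _)) // size_polyX.
rewrite (poly_moment_wide r c le_Xp) big_ord_recl coefXM mul0r add0r.
apply: eq_bigr => k _; rewrite coefXM lift0 /=.
by rewrite (_ : r + k.+1%:Z = r + 1 + k%:Z) //; lia.
Qed.

Lemma poly_momentXnM r c m p :
  poly_moment r c ('X^m * p) = poly_moment (r + m%:Z) c p.
Proof.
elim: m r => [|m IHm] r; first by rewrite mul1r addr0.
by rewrite exprS -mulrA poly_momentXM IHm -addrA -natz -mulrS natz.
Qed.

Lemma poly_moment_rVpoly r c n (v : 'rV[K]_n) (j : 'I_n) :
  poly_moment r (c + j%:Z) (rVpoly v) = (v *m moment_mx r c n) 0 j.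
Proof.
rewrite (poly_moment_wide _ _ (size_poly _ _)) mxE.
by apply: eq_bigr => k _; rewrite coef_rVpoly_ord mxE.
Qed.

End PolyMoments.

(** Multiplying the moment matrix by the last row of its adjugate gives
    Delta_(n+1) times the last basis vector; the last entry of that row is
    Delta_n, by which it is divided to make the polynomial monic. The
    definition is locked to keep unification from comparing these polynomials
    by expanding determinants. *)
HB.lock Definition biorth (K : fieldType) (F : {linear laurent2 K -> K^o})
    (r c : int) (n : nat) : {poly K} :=
  (Delta F r c n)^-1 *: rVpoly (row ord_max (\adj (moment_mx F r c n.+1))).

Section Biorthogonal.

Variables (K : fieldType) (F : {linear laurent2 K -> K^o}).
Implicit Types (r c : int) (n : nat) (p q : {poly K}).

Notation poly_moment := (poly_moment F).
Notation moment_mx := (moment_mx F).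
Notation biorth := (biorth F).

Lemma size_biorth r c n : (size (biorth r c n) <= n.+1)%N.
Proof. by rewrite biorth.unlock (leq_trans (size_scale_leq _ _)) // size_poly. Qed.

Lemma coef_biorth_gt r c n k : (n < k)%N -> (biorth r c n)`_k = 0.
Proof. by move=> lt_nk; rewrite nth_default // (leq_trans (size_biorth r c n)). Qed.

Lemma poly_moment_biorth r c n (j : 'I_n.+1) :
  poly_moment r (c + j%:Z) (biorth r c n) = (hcoef F r c n) *+ (ord_max == j).
Proof.
rewrite biorth.unlock poly_momentZ poly_moment_rVpoly -row_mul mul_adj_mx !mxE.
by rewrite mulrnAr /hcoef [in RHS]mulrC.
Qed.

Lemma biorth_orth r c n m : c <= m -> m < c + n%:Z ->
  poly_moment r m (biorth r c n) = 0.
Proof.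
move=> le_cm lt_mn; have lt_jn : (`|m - c| < n.+1)%N by lia.
rewrite (_ : m = c + (Ordinal lt_jn)%:Z); last by rewrite /=; lia.
by rewrite poly_moment_biorth -val_eqE /= (_ : (n == _) = false) //; lia.
Qed.

Lemma biorth_norm r c n m : m = c + n%:Z ->
  poly_moment r m (biorth r c n) = hcoef F r c n.
Proof. by move->; rewrite (poly_moment_biorth r c (@ord_max n)) eqxx. Qed.

Hypothesis Delta_neq0 : forall r c n, Delta F r c n != 0.

Lemma hcoef_neq0 r c n : hcoef F r c n != 0.
Proof. by rewrite mulf_neq0 ?invr_eq0. Qed.

Lemma biorth_lead r c n : (biorth r c n)`_n = 1.
Proof.
rewrite biorth.unlock coefZ -[n in X in _ * X]/(nat_of_ord (@ord_max n)).
rewrite coef_rVpoly_ord !mxE.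
rewrite /cofactor -signr_odd oddD addbb mul1r.
rewrite -[RHS](mulVf (Delta_neq0 r c n)); congr (_ * \det _).
by apply/matrixP=> i j; rewrite !mxE !lift_max.
Qed.

Lemma biorth0 r c : biorth r c 0 = 1.
Proof.
by rewrite (size1_polyC (size_biorth r c 0)) biorth_lead.
Qed.

(** The moment matrix, of determinant Delta_n, is invertible: the n moments
    determine the n coefficients. *)
Lemma orth_eq0 r c n q : (size q <= n)%N ->
  (forall j : nat, (j < n)%N -> poly_moment r (c + j%:Z) q = 0) -> q = 0.
Proof.
move=> le_qn q_orth; rewrite -(poly_rV_K le_qn).
suff -> : poly_rV q = 0 :> 'rV_n by rewrite linear0.
have M_unit : moment_mx r c n \in unitmx by rewrite unitmxE unitfE Delta_neq0.
apply: (can_inj (mulmxK M_unit)); rewrite mul0mx.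
by apply/rowP=> j; rewrite -poly_moment_rVpoly poly_rV_K // q_orth // mxE.
Qed.

(** The leading terms cancel, so the difference of the two sides has degree at
    most n, and its moments against y^c, ..., y^(c+n-1) vanish by orthogonality.
    The moment against y^(c+n) is h^(r+1,c)_n - a h^(r,c)_n = 0. *)
Lemma biorth_adjacent_row r c n :
  'X * biorth (r + 1) c n =
  biorth r c n.+1 + acoef F r c n *: biorth r c n.
Proof.
apply/eqP; rewrite -subr_eq0 opprD addrA; apply/eqP.
apply: (@orth_eq0 r c n.+1) => [|j].
  apply/leq_sizeP => k le_nk; rewrite !coefB coefZ coefXM.
  have [lt_nk|le_kn] := ltnP n.+1 k.
    case: k lt_nk {le_nk} => // k lt_nk /=.
    by rewrite !coef_biorth_gt ?(ltnW lt_nk) // mulr0 !subr0.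
  have -> : k = n.+1 by lia.
  by rewrite /= !biorth_lead coef_biorth_gt // mulr0 subr0 subrr.
rewrite ltnS leq_eqVlt => /orP[/eqP ->|lt_jn].
  rewrite !poly_momentB poly_momentZ poly_momentXM.
  rewrite [X in _ - X - _]biorth_orth; try lia.
  rewrite !biorth_norm //.
  by rewrite /acoef subr0 divfK ?hcoef_neq0 ?subrr.
rewrite !poly_momentB poly_momentZ poly_momentXM !biorth_orth; try lia.
by rewrite mulr0 !subr0.
Qed.

(** As above, with the exponents of y counted from c+1: the left-hand side is
    orthogonal to y^(c+1), ..., y^(c+n), and the moment against y^(c+n+1) is
    h^(r,c)_(n+1) - b h^(r,c+1)_n = 0. *)
Lemma biorth_adjacent_col r c n :
  biorth r c n.+1 =
  biorth r (c + 1) n.+1 + bcoef F r c n.+1 *: biorth r (c + 1) n.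
Proof.
apply/eqP; rewrite -subr_eq0 opprD addrA; apply/eqP.
apply: (@orth_eq0 r (c + 1) n.+1) => [|j].
  apply/leq_sizeP => k le_nk; rewrite !coefB coefZ.
  rewrite [(biorth r (c + 1) n)`_k]coef_biorth_gt //.
  have [lt_nk|le_kn] := ltnP n.+1 k.
    by rewrite !coef_biorth_gt // mulr0 !subr0.
  have -> : k = n.+1 by lia.
  by rewrite !biorth_lead mulr0 subr0 subrr.
rewrite ltnS leq_eqVlt => /orP[/eqP ->|lt_jn].
  rewrite !poly_momentB poly_momentZ [X in X - _ - _]biorth_norm; last by lia.
  rewrite [X in _ - X - _]biorth_orth; try lia.
  rewrite biorth_norm // /bcoef subr0.
  by rewrite divfK ?hcoef_neq0 ?subrr.
rewrite !poly_momentB poly_momentZ !biorth_orth; try lia.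
by rewrite mulr0 !subr0.
Qed.

(** The polynomials Q(i, j): truncated subtraction merges the cases j < i and
    i <= j. *)
Definition staircase_poly (i j : nat) : {poly K} :=
  'X^(i - j) * biorth (i - j)%N (j - i)%N (minn i j).

Lemma staircase_below (k j : nat) :
  staircase_poly (k + j) j = 'X^k * biorth k 0 j.
Proof.
have col0 : (j - (k + j) = 0)%N by lia.
by rewrite /staircase_poly addnK (minn_idPr (leq_addl k j)) col0.
Qed.

Lemma staircase_above (i k : nat) : staircase_poly i (k + i) = biorth 0 k i.
Proof.
have row0 : (i - (k + i) = 0)%N by lia.
by rewrite /staircase_poly addnK (minn_idPl (leq_addl k i)) row0 mul1r.
Qed.

(** The scalar is the label of the edge between (i+1, j) and (i, j). For j <= i
    this is the first adjacent relation multiplied by x^(i-j), and for j > i it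
    is the second. *)
Lemma staircase_rec (i j : nat) :
  staircase_poly i.+1 j = staircase_poly i.+1 j.+1
    + (if (j < i.+1)%N then acoef F (i.+1%:Z - j%:Z - 1) 0 j
       else bcoef F 0 (j%:Z - i.+1%:Z) i.+1) *: staircase_poly i j.
Proof.
case: ltnP => [le_ji | lt_ij].
  have [k ->] : exists k, i = (k + j)%N by exists (i - j)%N; lia.
  have -> : (k + j).+1%:Z - j%:Z - 1 = k%:Z :> int by lia.
  rewrite -addSn staircase_below addSnnS !staircase_below.
  have -> : k.+1%:Z = k%:Z + 1 :> int by lia.
  by rewrite exprSr -mulrA biorth_adjacent_row mulrDr scalerAr.
have [k ->] : exists k, j = (k + i.+1)%N by exists (j - i.+1)%N; lia.
have -> : (k + i.+1)%N%:Z - i.+1%:Z = k%:Z :> int by lia.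
rewrite -addSn !staircase_above -addSnnS staircase_above.
have -> : k.+1%:Z = k%:Z + 1 :> int by lia.
exact: biorth_adjacent_col.
Qed.

Lemma staircase_row0 (j : nat) : staircase_poly 0 j = 1.
Proof. by rewrite /staircase_poly min0n biorth0 mul1r. Qed.

Lemma staircase_col0 (i : nat) : staircase_poly i 0 = 'X^i.
Proof. by rewrite /staircase_poly minn0 biorth0 mulr1 subn0. Qed.

(** Up to its power of x, the polynomial at (i+1, c+1) is orthogonal to the
    min(i+1, c+1) consecutive powers of y that end with y^c. *)
Lemma staircase_orth (i c : nat) :
  poly_moment 0 c (staircase_poly i.+1 c.+1) = 0.
Proof. by rewrite poly_momentXnM add0r biorth_orth //; lia. Qed.

End Biorthogonal.

Theorem theorem2 (K : fieldType) (F : {linear laurent2 K -> K^o})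
    (alpha : nat -> nat -> K)
    (Delta_neq0 : forall (r c : int) (n : nat), Delta F r c n != 0)
    (alphaE : forall i j : nat, (0 < i)%N ->
       alpha i j = if (j < i)%N then acoef F (i%:Z - j%:Z - 1) 0 j
                   else bcoef F 0 (j%:Z - i%:Z) i)
    (r c : nat) :
  moment F r%:Z c%:Z / moment F 0 c%:Z =
  \sum_(P : lattice_path (r, 0%N) (0%N, c)) path_weight alpha P.
Proof.
have f0c_neq0 : moment F 0 c%:Z != 0.
  by have := Delta_neq0 0 c 1; rewrite /Delta det_mx11 mxE !addr0.
apply: canLR (mulfK f0c_neq0) _; rewrite mulrC -/(path_sum alpha _ _).
have -> : moment F r c = poly_moment F 0 c (staircase_poly F r 0).
  by rewrite staircase_col0 // -['X^r]mulr1 poly_momentXnM poly_moment1 add0r.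
pose g i j := poly_moment F 0 c (staircase_poly F i j).
apply: (@path_sum_unique _ _ g) => // [j _ | i | i j _]; rewrite /g.
- by rewrite staircase_row0 // poly_moment1.
- exact: staircase_orth.
- by rewrite staircase_rec // poly_momentD poly_momentZ alphaE.
Qed.
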